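(* Let $p>1$ and let $G$ be a finite simple connected graph with exactly $n\geq 4$ edges and with nonempty boundary $B(G)$. Then $$\lambda_{1,p}(G)\geq \lambda_{1,p}(T_{n,3}),$$ and equality holds if and only if $G$ is isomorphic to $T_{n,3}$.
   Context: For a finite simple connected graph $G$, its boundary is $B(G)=\{x\in V(G): \deg(x)=1\}$ (the pendant vertices) and its interior is $\Omega(G)=V(G)\setminus B(G)$. For $p\ge 1$, let $C_B(G)=\{f\in\mathbb{R}^{V(G)}: f|_{B(G)}\equiv 0\}$ and define the first $p$-Dirichlet eigenvalue $$\lambda_{1,p}(G)=\min_{f\in C_B(G)\setminus\{0\}}\frac{\sum_{\{x,y\}\in E(G)}|f(x)-f(y)|^p}{\sum_{x\in V(G)}|f(x)|^p}.$$ For $n>i\ge 3$, the tadpole graph $T_{n,i}$ is the graph on vertices $t_1,\dots,t_n$ with edges $t_n\sim t_{n-1}\sim\cdots\sim t_i\sim t_{i-1}\sim\cdots\sim t_2\sim t_1\sim t_i$, i.e. a cycle of length $i$ with a path attached at $t_i$; it has $n$ vertices and $n$ edges and its only boundary vertex is $t_n$. *)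

(* Defs.v *)
From HB Require Import structures.
From mathcomp Require Import all_boot all_order all_algebra.
From mathcomp Require Import all_classical all_reals all_analysis.
Set Implicit Arguments. Unset Strict Implicit. Unset Printing Implicit Defensive.
Import Order.TTheory GRing.Theory Num.Theory.
Local Open Scope ring_scope.
 

Definition simple_graph (T : finType) (e : rel T) : Prop :=
  symmetric e /\ irreflexive e.

Definition graph_connected (T : finType) (e : rel T) : Prop :=
  forall x y : T, connect e x y.

Definition deg (T : finType) (e : rel T) (x : T) : nat := #|[set y | e x y]|.

Definition boundary (T : finType) (e : rel T) : {set T} :=
  [set x | deg e x == 1%N].

Definition edges (T : finType) (e : rel T) : {set {set T}} :=
  [set E : {set T} | [exists x, exists y, e x y && (E == (x |: [set y])%SET)]].

Definition num_edges (T : finType) (e : rel T) : nat := #|edges e|.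

(* sum over edges {x,y} of |f x - f y|^p ; each unordered edge is counted
   twice in the ordered double sum, hence the factor 1/2 *)
Definition edge_energy (R : realType) (T : finType) (e : rel T) (p : R)
  (f : T -> R) : R :=
  2^-1 * \sum_(x : T) \sum_(y : T | e x y) (`|f x - f y| `^ p).

Definition vertex_mass (R : realType) (T : finType) (p : R) (f : T -> R) : R :=
  \sum_(x : T) (`|f x| `^ p).

Definition CB_nonzero (R : realType) (T : finType) (e : rel T) : set (T -> R) :=
  [set f : T -> R | (forall x, x \in boundary e -> f x = 0) /\ (exists x, f x != 0)].

(* first p-Dirichlet eigenvalue: the minimum (= infimum, which is attained)
   of the Rayleigh quotient over C_B(G) \ {0} *)
Definition lambda1p (R : realType) (T : finType) (e : rel T) (p : R) : R :=
  inf (classical_sets.image (@CB_nonzero R T e)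
         (fun f => edge_energy e p f / vertex_mass p f)).

(* Tadpole graph T_{n,i} on 'I_n, with t_k encoded as the ordinal k-1:
   path edges k ~ k+1 (0 <= k < n-1) plus the cycle-closing edge 0 ~ i-1. *)
Definition tadpole (n i : nat) : rel 'I_n :=
  fun x y => [|| (x.+1 == y :> nat), (y.+1 == x :> nat),
                 ((x == 0 :> nat) && (y == i.-1 :> nat))
               | ((y == 0 :> nat) && (x == i.-1 :> nat))].

Arguments tadpole : clear implicits.
Definition graph_iso (T1 T2 : finType) (e1 : rel T1) (e2 : rel T2) : Prop :=
  exists phi : T1 -> T2, bijective phi /\ forall x y, e2 (phi x) (phi y) = e1 x y.

(* Main.v *)
Require Import Defs.
From HB Require Import structures.
From mathcomp Require Import all_boot all_order all_algebra.
From mathcomp Require Import all_classical all_reals all_analysis.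
From mathcomp Require Import zify ring lra.
Set Implicit Arguments. Unset Strict Implicit. Unset Printing Implicit Defensive.
Import Order.TTheory GRing.Theory Num.Theory.
Import numFieldNormedType.Exports.
Local Open Scope ring_scope.

(* Let f >= 0 be a minimizer of the Rayleigh quotient of G, and let
   a_0 >= a_1 >= ... be its values on the interior vertices in decreasing order,
   padded with zeros.  By the handshake lemma G has at most n - 1 interior
   vertices, so (a_k) is a test function on T_{n,3}, of the same mass as f.
   Superadditivity of t |-> t^p lets one cut f at any level c into min(f, c) and
   (f - c)^+ without increasing the energy.  Cutting at a_2, a_3, ..., each layer
   below a_2 costs at least its height to the p-th power because G is connected,
   and the part above a_2 costs at least as much as on the triangle because the
   two top vertices have degree at least 2.  Hence a has no more energy on T_{n,3}
   than f has on G.  If the eigenvalues agree then a minimizes on T_{n,3}; this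
   forces a_1 > a_2 > ... > a_{n-1} = 0, since raising the vertices above a
   plateau by h costs O(h^p) energy and gains mass of order h.  No edge of G can
   then jump over a level a_k with k >= 2, as cutting there would be strict, so G
   contains T_{n,3}, and both have n edges. *)

(** * p-th powers *)

Section PowerInequalities.
Context {R : realType} (p : R).
Hypothesis p1 : 1 < p.

Let p0 : 0 < p. Proof. exact: lt_trans p1. Qed.
Let pN0 : p != 0. Proof. by rewrite gt_eqF. Qed.

Lemma ler_normX (x y : R) : `|x| <= `|y| -> `|x| `^ p <= `|y| `^ p.
Proof. by move=> xy; apply: ge0_ler_powR; rewrite ?nnegrE ?normr_ge0// ltW. Qed.

Lemma norm0X : `|0 : R| `^ p = 0.
Proof. by rewrite normr0 powR0. Qed.

Lemma normX_gt0 (x : R) : x != 0 -> 0 < `|x| `^ p.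
Proof. by move=> x0; rewrite powR_gt0 // normr_gt0. Qed.

(** Write [x^p] as [x * x^(p-1)] and bound [u^(p-1)] and [v^(p-1)] by [(u+v)^(p-1)]. *)
Lemma powR_superadd (u v : R) : 0 <= u -> 0 <= v ->
  u `^ p + v `^ p <= (u + v) `^ p.
Proof.
move=> u0 v0; rewrite -!(@mulr_powRB1 _ _ p) ?addr_ge0// mulrDl.
by apply: lerD; apply: ler_wpM2l => //; apply: ge0_ler_powR;
   rewrite ?nnegrE ?subr_ge0 ?addr_ge0 ?lerDl ?lerDr// ltW.
Qed.

Lemma powR_superadd_lt (u v : R) : 0 < u -> 0 < v ->
  u `^ p + v `^ p < (u + v) `^ p.
Proof.
move=> u0 v0; rewrite -!(@mulr_powRB1 _ _ p) ?addr_ge0 ?ltW// mulrDl.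
by apply: ltrD; rewrite ltr_pM2l//; apply: gt0_ltr_powR;
   rewrite ?nnegrE ?subr_gt0 ?subr_ge0 ?addr_ge0 ?ltrDl ?ltrDr// ltW.
Qed.

(** A Bernoulli inequality with slope [x^(p-1)] in place of [p * x^(p-1)]; it supplies a mass gain
    linear in [h]. *)
Lemma powR_increment (x h : R) : 0 < x -> 0 <= h ->
  x `^ p + h * x `^ (p - 1) <= (x + h) `^ p.
Proof.
move=> /ltW x0 h0; rewrite -!(@mulr_powRB1 _ _ p) ?addr_ge0// -mulrDl.
apply: ler_wpM2l; first by rewrite addr_ge0.
by apply: ge0_ler_powR; rewrite ?nnegrE ?subr_ge0 ?addr_ge0 ?lerDl// ltW.
Qed.

Let cut_le (u v c : R) : u <= v ->
  `|Num.min u c - Num.min v c| `^ p + `|Num.max (u - c) 0 - Num.max (v - c) 0| `^ p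
  <= `|u - v| `^ p.
Proof.
move=> uv.
have [uc|cu] := leP u c; have [vc|cv] := leP v c.
- rewrite !max_r ?subr_le0// subrr norm0X addr0 //.
- have {}cv := ltW cv.
  rewrite max_r ?subr_le0// max_l ?subr_ge0// sub0r normrN.
  rewrite (distrC u c) (distrC u v) !ger0_norm ?subr_ge0//.
  have -> : v - u = (c - u) + (v - c) by lra.
  by apply: powR_superadd; rewrite subr_ge0.
- by lra.
- have {}cu := ltW cu; have {}cv := ltW cv.
  rewrite !max_l ?subr_ge0// subrr norm0X add0r.
  by have -> : u - c - (v - c) = u - v by lra.
Qed.

(** The parts below and above [c] have differences of the same sign adding up to [u - v], so
    superadditivity applies. *)
Lemma normX_cut (u v c : R) :
  `|Num.min u c - Num.min v c| `^ p + `|Num.max (u - c) 0 - Num.max (v - c) 0| `^ p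
  <= `|u - v| `^ p.
Proof.
have [uv|vu] := leP u v; first exact: cut_le.
rewrite (distrC u v) (distrC (Num.min u c)) (distrC (Num.max (u - c) 0)).
exact/cut_le/ltW.
Qed.

Lemma normX_cut_lt (u v c : R) : v < c -> c < u ->
  `|Num.min u c - Num.min v c| `^ p + `|Num.max (u - c) 0 - Num.max (v - c) 0| `^ p
  < `|u - v| `^ p.
Proof.
move=> vc cu; rewrite (min_r (ltW cu)) (min_l (ltW vc)).
rewrite (@max_l _ _ (u - c)) ?subr_ge0 ?(ltW cu)//.
rewrite (@max_r _ _ (v - c)) ?subr_le0 ?(ltW vc)// subr0.
rewrite !gtr0_norm ?subr_gt0//; last exact: lt_trans vc cu.
have -> : u - v = (c - v) + (u - c) by lra.
by apply: powR_superadd_lt; rewrite subr_gt0.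
Qed.

Lemma continuous_normX : continuous (fun x : R => `|x| `^ p).
Proof.
(* Away from 0 differentiability of the power suffices; at 0 the bound [|y|^p <= |y|] for [|y| <= 1]
   replaces it. *)
move=> x; have [->|x0] := eqVneq x 0.
  rewrite /continuous_at norm0X; apply/cvgrPdist_lt => e e0.
  near=> y; rewrite sub0r normrN ger0_norm ?powR_ge0//.
  have ye : `|y| < e.
    by near: y; exact: (@nbhs0_lt R R^o).
  have y1 : `|y| <= 1.
    by near: y; exact: (@nbhs0_le R R^o).
  apply: le_lt_trans ye.
  have [->|y0] := eqVneq y 0; first by rewrite norm0X normr0.
  by rewrite ge1r_powR ?normr_gt0 ?y0 ?y1// ltW.
apply: (@continuous_comp _ _ _ (fun x : R => `|x|) (fun x => x `^ p)).
  exact: norm_continuous.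
apply/differentiable_continuous/derivable1_diffP.
by apply: derivable_powR; rewrite in_itv/= andbT normr_gt0.
Unshelve. all: by end_near. Qed.

End PowerInequalities.

Lemma continuous_sumr {K : numFieldType} {X : topologicalType} (I : Type)
    (s : seq I) (P : pred I) (F : I -> X -> K) :
  (forall i, continuous (F i)) ->
  continuous (fun x => \sum_(i <- s | P i) F i x).
Proof.
move=> cF; elim: s => [|i s IH].
  under [fun _ => _]eq_fun do rewrite big_nil; exact: cst_continuous.
under [fun _ => _]eq_fun do rewrite big_cons.
by case: (P i) => // x; apply: continuousD; [exact: cF|exact: IH].
Qed.

(** * Existence of a minimizer *)

Lemma continuous_proj {K : numFieldType} (T : finType) (x : T) :
  continuous (fun f : prod_topology (fun _ : T => K) => f x).
Proof. exact: (@proj_continuous _ (fun _ : T => K) x). Qed.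

Section Rayleigh.
Context {R : realType} (p : R) (T : finType) (e : rel T).
Hypothesis p1 : 1 < p.

Lemma edge_energy_ge0 (f : T -> R) : 0 <= edge_energy e p f.
Proof.
by apply: mulr_ge0 => //; do 2!apply: sumr_ge0 => ? _; exact: powR_ge0.
Qed.

Lemma vertex_mass_gt0 (f : T -> R) x : f x != 0 -> 0 < vertex_mass p f.
Proof.
move=> fx; rewrite /vertex_mass (bigD1 x)//= ltr_pwDl ?normX_gt0//.
by apply: sumr_ge0 => ? _; exact: powR_ge0.
Qed.

Lemma rayleigh_ge0 (f : T -> R) : 0 <= edge_energy e p f / vertex_mass p f.
Proof.
by rewrite divr_ge0 ?edge_energy_ge0// sumr_ge0// => ? _; exact: powR_ge0.
Qed.

Lemma lambda1p_le (f : T -> R) : CB_nonzero e f ->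
  lambda1p e p <= edge_energy e p f / vertex_mass p f.
Proof.
move=> CBf; apply: ge_inf; last by exists f.
by exists 0 => _ [g _ <-]; exact: rayleigh_ge0.
Qed.

Lemma lambda1p_min (f : T -> R) : CB_nonzero e f ->
  (forall g, CB_nonzero e g -> edge_energy e p f / vertex_mass p f <=
                               edge_energy e p g / vertex_mass p g) ->
  lambda1p e p = edge_energy e p f / vertex_mass p f.
Proof.
move=> CBf fmin; apply/eqP; rewrite eq_le lambda1p_le//=.
by apply: lb_le_inf; [exists (edge_energy e p f / vertex_mass p f), f|
  move=> _ [g CBg <-]; exact: fmin].
Qed.

Lemma continuous_energy :
  continuous (edge_energy e p : prod_topology (fun _ : T => R) -> R).
Proof.
move=> f; apply: (@continuousM _ _ (fun=> 2^-1)
  (fun f : prod_topology (fun _ : T => R) =>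
     \sum_x \sum_(y | e x y) `|f x - f y| `^ p)); first exact: cst_continuous.
move: f; apply: continuous_sumr => x; apply: continuous_sumr => y f.
apply: (@continuous_comp _ _ _ (fun f : prod_topology (fun _ : T => R) => f x - f y)
   (fun u : R => `|u| `^ p)); last exact: continuous_normX.
by apply: continuousB; exact: continuous_proj.
Qed.

Lemma continuous_mass :
  continuous (vertex_mass p : prod_topology (fun _ : T => R) -> R).
Proof.
apply: continuous_sumr => x f.
apply: (@continuous_comp _ _ _ (fun f : prod_topology (fun _ : T => R) => f x)
   (fun u : R => `|u| `^ p)); last exact: continuous_normX.
exact: continuous_proj.
Qed.

(** Functions normalized to have their largest value 1 at [x]. For fixed [x] they form a product of
    compact sets, on which the mass never vanishes. *)
Let peak (x i : T) : set R :=
  if i == x then [set 1]%classic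
  else if i \in boundary e then [set 0]%classic else `[0, 1]%classic.

Let peaked (x : T) : set (prod_topology (fun _ : T => R)) :=
  [set f | forall i, peak x i (f i)]%classic.

Let peaked_compact x : compact (peaked x).
Proof.
apply: tychonoff => i; rewrite /peak; case: ifP => _.
  exact: compact_set1.
by case: ifP => _; [exact: compact_set1|exact: segment_compact].
Qed.

Let peaked_min x : x \notin boundary e ->
  exists2 f, peaked x f & forall g, peaked x g ->
    edge_energy e p f / vertex_mass p f <= edge_energy e p g / vertex_mass p g.
Proof.
move=> xI.
have /compact_EVT_min := @peaked_compact x.
have ne : (peaked x !=set0)%classic.
  exists (fun i => (i == x)%:R) => i; rewrite /peak; case: eqP => //= _.
  by case: ifP => // _; rewrite /= in_itv /= lexx ler01.
move=> /(_ _ (fun f => edge_energy e p f / vertex_mass p f) ne)[].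
  apply: continuous_in_subspaceT => f /set_mem fx.
  apply: continuousM; first exact: continuous_energy.
  apply: continuousV; last exact: continuous_mass.
  apply/lt0r_neq0/(vertex_mass_gt0 (x := x)).
  by have := fx x; rewrite /peak eqxx => ->; rewrite oner_eq0.
move=> f /set_mem fx fmin; exists f => // g gx.
by apply: fmin; exact/mem_set.
Qed.

(** Taking moduli does not raise the energy, by the reverse triangle inequality, and the factor
    [s^p] cancels. *)
Lemma rayleigh_normalize (g : T -> R) (s : R) : 0 < s ->
  edge_energy e p (fun x => s * `|g x|) / vertex_mass p (fun x => s * `|g x|)
  <= edge_energy e p g / vertex_mass p g.
Proof.
move=> s0.
have sX (u : R) : `|s * u| `^ p = s `^ p * `|u| `^ p.
  by rewrite normrM powRM// gtr0_norm.
have -> : vertex_mass p (fun x => s * `|g x|) = s `^ p * vertex_mass p g.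
  by rewrite /vertex_mass mulr_sumr; apply: eq_bigr => x _; rewrite sX normr_id.
have Ele : edge_energy e p (fun x => s * `|g x|) <= s `^ p * edge_energy e p g.
  rewrite /edge_energy mulrCA ler_wpM2l// mulr_sumr ler_sum// => x _.
  rewrite mulr_sumr ler_sum// => y _; rewrite -mulrBr sX ler_wpM2l ?powR_ge0//.
  by apply: ler_normX => //; exact: ler_dist_dist.
have sp0 : s `^ p != 0 by rewrite gt_eqF// powR_gt0.
rewrite invfM mulrA ler_wpM2r//.
  by rewrite invr_ge0 sumr_ge0// => ? _; exact: powR_ge0.
by rewrite ler_pdivrMr ?powR_gt0// mulrC.
Qed.

(** Minimize over the functions peaked at each interior [x], then over the finitely many [x]; every
    competitor normalizes into one of these compact sets. *)
Lemma exists_minimizer : (exists x, x \notin boundary e) ->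
  exists f : T -> R, [/\ forall x, 0 <= f x, CB_nonzero e f &
    forall g, CB_nonzero e g -> edge_energy e p f / vertex_mass p f <=
                                edge_energy e p g / vertex_mass p g].
Proof.
move=> [x0 x0I].
have /boolp.choice[c cP] : forall x, exists f : T -> R, x \notin boundary e ->
    peaked x f /\ forall g, peaked x g ->
    edge_energy e p f / vertex_mass p f <= edge_energy e p g / vertex_mass p g.
  move=> x; have [xI|xB] := boolP (x \notin boundary e).
    by have [f fx fmin] := peaked_min xI; exists f.
  (* A dummy value: [c] is evaluated at interior vertices only. *)
  by exists (fun=> 0).
pose r x := edge_energy e p (c x) / vertex_mass p (c x).
case: (@arg_minP _ _ _ x0 (fun x => x \notin boundary e) r x0I) => x xI xmin.
have [cx _] := cP _ xI.
exists (c x); split.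
- move=> i; have := cx i; rewrite /peak; case: ifP => _; first by move=> ->.
  by case: ifP => _; [move=> ->|rewrite /= in_itv => /andP[]].
- split=> [i iB|].
    have := cx i; rewrite /peak iB; case: ifP => // /eqP ix.
    by move: xI; rewrite -ix iB.
  by exists x; have := cx x; rewrite /peak eqxx => ->; exact: oner_neq0.
move=> g [gB [y gy]].
(* The modulus of [g] is largest at [z], which is interior since [g z] is nonzero; dividing by
   [|g z|] makes [|g|] peaked at [z]. *)
case: (@arg_maxP _ _ _ y predT (fun x => `|g x|) isT) => z _ zmax.
have gz : g z != 0.
  by rewrite -normr_gt0 (lt_le_trans _ (zmax y isT))// normr_gt0.
have zI : z \notin boundary e.
  by apply/negP => /gB gz0; rewrite gz0 eqxx in gz.
apply: le_trans (xmin _ zI) _.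
have s0 : 0 < `|g z|^-1 by rewrite invr_gt0 normr_gt0.
apply: le_trans (rayleigh_normalize g s0).
apply: (cP _ zI).2 => i; rewrite /peak.
case: eqP => [->|_]; first by rewrite /= mulVf// normr_eq0.
case: ifP => [/gB ->|_]; first by rewrite /= normr0 mulr0.
rewrite /= in_itv/= mulr_ge0 ?(ltW s0)//= mulrC ler_pdivrMr ?normr_gt0// mul1r.
exact: zmax.
Qed.

End Rayleigh.

(** * Finite connected graphs *)

Section Graphs.
Context (T : finType) (e : rel T).

Lemma deg_sum (x : T) : deg e x = (\sum_(y | e x y) 1)%N.
Proof. by rewrite sum1dep_card; apply: eq_card => y; rewrite !inE. Qed.

Lemma sum_deg_card : (\sum_x deg e x = #|[set q : T * T | e q.1 q.2]|)%N.
Proof.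
rewrite -sum1dep_card -(pair_big_dep xpredT e (fun _ _ => 1%N)) /=.
by apply: eq_bigr => x _; rewrite deg_sum.
Qed.

Lemma deg_gt0P (x : T) : reflect (exists y, e x y) (0 < deg e x)%N.
Proof.
by apply: (iffP card_gt0P) => -[y yP]; exists y; rewrite inE in yP *.
Qed.

Lemma deg_ge2_avoid (x z : T) : (1 < deg e x)%N -> exists2 y, e x y & y != z.
Proof.
move=> /card_gt1P[u [v [+ + uv]]]; rewrite !inE => xu xv.
have [uz|uz] := eqVneq u z; last by exists u.
by exists v => //; rewrite -uz eq_sym.
Qed.

Hypothesis eG : simple_graph e.

Let e_sym : symmetric e. Proof. by case: eG. Qed.
Let e_irr : irreflexive e. Proof. by case: eG. Qed.

(** Double counting of ordered adjacent pairs: exactly two of them lie over each edge. *)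
Lemma handshake : (\sum_x deg e x = (num_edges e).*2)%N.
Proof.
rewrite sum_deg_card -sum1_card.
rewrite (partition_big (fun q : T * T => [set q.1; q.2]%SET) (mem (edges e))) /=.
  rewrite -muln2 -sum_nat_const; apply: eq_bigr => A.
  rewrite inE => /existsP[x /existsP[y /andP[exy /eqP ->]]].
  have xy : (x, y) != (y, x).
    by apply/eqP => -[xy _]; rewrite xy e_irr in exy.
  have -> : 2%N = #|[set (x, y); (y, x)]| by rewrite cards2 xy.
  rewrite sum1dep_card; apply: eq_card => -[u v]; rewrite !inE /= !xpair_eqE.
  apply/andP/orP => [[euv /eqP E]|].
    have := set21 u v; have := set22 u v; rewrite E !inE.
    have : u != v by apply/eqP => uv; rewrite uv e_irr in euv.
    by move=> uv /orP[] /eqP uE /orP[] /eqP vE; rewrite uE vE ?eqxx in uv *; auto.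
  by case=> /andP[/eqP -> /eqP ->]; [|rewrite finset.setUC e_sym]; split.
move=> [u v]; rewrite !inE /= => euv.
by apply/existsP; exists u; apply/existsP; exists v; rewrite euv eqxx.
Qed.

Hypothesis eC : graph_connected e.

(** Otherwise [S] would be closed under adjacency and contain the whole component of [x]. *)
Lemma crossing_edge (S : {set T}) (x y : T) : x \in S -> y \notin S ->
  exists u v, [/\ e u v, u \in S & v \notin S].
Proof.
move=> xS yS.
have [/existsP[u /existsP[v /and3P[]]]|] :=
    boolP [exists u, exists v, [&& e u v, u \in S & v \notin S]].
  by exists u, v.
move=> /existsPn noc.
have clS : fingraph.closed e S.
  apply: (intro_closed (sym_connect_sym e_sym)) => u v euv uS.
  by have /existsPn/(_ v) := noc u; rewrite euv uS /= negbK.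
by have := closed_connect clS (eC x y); rewrite xS (negbTE yS).
Qed.

Lemma deg_gt0 (x y : T) : x != y -> (0 < deg e x)%N.
Proof.
move=> xy; have yS : y \notin [set x] by rewrite inE eq_sym.
have [u [v [euv + _]]] := crossing_edge (set11 x) yS.
by rewrite inE => /eqP <-; apply/deg_gt0P; exists v.
Qed.

Lemma interior_deg (b x : T) :
  b \in boundary e -> x \notin boundary e -> (1 < deg e x)%N.
Proof.
move=> bB xI; have xb : x != b by apply: contraNneq xI => ->.
by have := deg_gt0 xb; move: xI; rewrite inE; case: (deg e x) => [|[]].
Qed.

(** Interior vertices have degree at least 2 and [b] adds 1 more to the degree sum, which is twice
    the number of edges. *)
Lemma interior_card (b : T) : b \in boundary e ->
  (#|~: boundary e| < num_edges e)%N.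
Proof.
move=> bB.
rewrite -ltn_double -handshake (bigID (mem (boundary e))) /=.
rewrite -muln2 -sum_nat_const -add1n leq_add //.
  by have := bB; rewrite inE (bigD1 b)//= => /eqP ->.
rewrite [X in (_ <= X)%N](eq_bigl (mem (~: boundary e))); last first.
  by move=> x; rewrite !inE.
by apply: leq_sum => x; rewrite finset.in_setC; exact: interior_deg bB.
Qed.

(** If every vertex were pendant, [b] and its neighbour would be the whole graph, with a single
    edge. *)
Lemma interior_exists (b : T) : b \in boundary e -> (1 < num_edges e)%N ->
  exists x, x \notin boundary e.
Proof.
move=> bB n2; apply/existsP; apply: contraLR n2 => /existsPn allB.
have deg1 x : deg e x = 1%N.
  by have := allB x; rewrite negbK inE => /eqP.
have degP x y z : e x y -> e x z -> y = z.
  have /eqP/cards1P[w wP] := deg1 x.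
  move=> exy exz; have : y \in [set y | e x y] by rewrite inE.
  have : z \in [set y | e x y] by rewrite inE.
  by rewrite wP !inE => /eqP -> /eqP ->.
have /deg_gt0P[c ebc] : (0 < deg e b)%N by rewrite deg1.
have card2 : (#|T| <= 2)%N.
  rewrite leqNgt; apply/negP => T2.
  have [z zP] : exists z, z \notin [set b; c].
    apply/existsP; apply: contraLR T2 => /existsPn zP; rewrite -leqNgt.
    have : (#|T| <= #|[set b; c]|)%N.
      by apply/subset_leq_card/fintype.subsetP => z _; have := zP z; rewrite negbK.
    by rewrite cards2 => /leq_trans; apply; case: (b != c).
  have [u [v [euv]]] := @crossing_edge [set b; c] b z (set21 _ _) zP.
  rewrite !inE => /orP[] /eqP uE; rewrite uE in euv.
    by rewrite (degP _ _ _ euv ebc) eqxx orbT.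
  by rewrite (degP _ _ _ euv (_ : e c b)) ?eqxx// e_sym.
rewrite -leqNgt -leq_double -handshake.
under eq_bigr do rewrite deg1.
by rewrite sum1_card.
Qed.

End Graphs.

(** * The tadpole graph *)

Lemma sum_ord_eq (V : nmodType) (n c : nat) (G : nat -> V) :
  \sum_(y < n | c == y :> nat) G y = if (c < n)%N then G c else 0.
Proof.
case: ifP => [cn|cn].
  by rewrite (big_pred1 (Ordinal cn))// => y; rewrite /= eq_sym.
by rewrite big_pred0// => y; apply/eqP => cy; rewrite cy ltn_ord in cn.
Qed.

(** The four clauses of [tadpole] exclude each other: path steps up and down, and the chord between
    0 and 2 in both directions. Values in an [nmodType] cover both energies and degree counts. *)
Lemma tadpole_double_sum (V : nmodType) (n : nat) (F : nat -> nat -> V) :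
  (4 <= n)%N -> (forall i j, F i j = F j i) ->
  \sum_(x < n) \sum_(y < n | tadpole n 3 x y) F x y =
  (F 0%N 1%N + F 0%N 2%N + F 1%N 2%N + \sum_(2 <= k < n.-1) F k k.+1) *+ 2.
Proof.
move=> n4 Fsym.
pose up := \sum_(x < n) \sum_(y < n | x.+1 == y :> nat) F x y.
have upE : up = F 0%N 1%N + F 1%N 2%N + \sum_(2 <= k < n.-1) F k k.+1.
  rewrite /up; under eq_bigr do rewrite (sum_ord_eq _ _ (F _)).
  rewrite -(big_mkord xpredT (fun x => if (x.+1 < n)%N then F x x.+1 else 0)).
  have -> : n = n.-1.+1 by lia.
  rewrite big_nat_recr//= ltnn addr0.
  under eq_big_nat => k /andP[_ kn] do rewrite ltnS kn.
  by rewrite big_ltn 1?big_ltn ?addrA//; lia.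
pose chord := \sum_(x < n) \sum_(y < n | (x == 0%N :> nat) && (y == 2%N :> nat)) F x y.
have chordE : chord = F 0%N 2%N.
  rewrite /chord (eq_bigr (fun x : 'I_n => if 0%N == x then F x 2%N else 0)).
    by rewrite -big_mkcond (sum_ord_eq _ _ (F^~ 2%N)) ifT//; lia.
  move=> x _; rewrite eq_sym; case: eqP => _ /=; last by rewrite big_pred0.
  under eq_bigl do rewrite eq_sym.
  by rewrite sum_ord_eq ifT//; lia.
have downE : \sum_(x < n) \sum_(y < n | y.+1 == x :> nat) F x y = up.
  rewrite (exchange_big_dep xpredT)//=; apply: eq_bigr => x _.
  by apply: eq_bigr => y _; exact: Fsym.
have chord'E :
    \sum_(x < n) \sum_(y < n | (y == 0%N :> nat) && (x == 2%N :> nat)) F x y = chord.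
  rewrite (exchange_big_dep xpredT)//=; apply: eq_bigr => x _.
  by apply: eq_bigr => y _; exact: Fsym.
transitivity (up + up + (chord + chord)); last first.
  rewrite upE chordE [F 0%N 1%N + F 0%N 2%N + _]addrAC [X in X *+ 2]addrAC.
  by rewrite mulr2n [RHS]addrACA.
rewrite -{2}downE -{2}chord'E -!big_split /=; apply: eq_bigr => x _.
rewrite big_mkcond [X in X + _ + _]big_mkcond [X in _ + X + _]big_mkcond /=.
rewrite [X in _ + (X + _)]big_mkcond [X in _ + (_ + X)]big_mkcond -!big_split /=.
apply: eq_bigr => y _; rewrite /tadpole /=.
by do ![case: eqP => ? /=]; rewrite ?addr0 ?add0r//; lia.
Qed.

Lemma tadpole_boundary (n : nat) (x : 'I_n) : (4 <= n)%N ->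
  x \in boundary (tadpole n 3) -> x = n.-1 :> nat.
Proof.
move=> n4; rewrite inE => /eqP dx; apply/eqP/negP => /negP xn.
have xlt := ltn_ord x.
suff : (1 < deg (tadpole n 3) x)%N by rewrite dx.
have nbrs (i j : nat) (hi : (i < n)%N) (hj : (j < n)%N) : i <> j ->
    tadpole n 3 x (Ordinal hi) -> tadpole n 3 x (Ordinal hj) ->
    (1 < deg (tadpole n 3) x)%N.
  move=> ij ti tj; apply/card_gt1P; exists (Ordinal hi), (Ordinal hj).
  by split; rewrite ?inE//; apply/eqP => -[].
have [x0|x0] := eqVneq (x : nat) 0%N.
  by apply: (@nbrs 1%N 2%N); rewrite /tadpole /=; lia.
by apply: (@nbrs x.-1 x.+1); rewrite /tadpole /=; lia.
Qed.

Lemma tadpole_sum_deg (n : nat) : (4 <= n)%N ->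
  (\sum_(x < n) deg (tadpole n 3) x = n.*2)%N.
Proof.
move=> n4; under eq_bigr do rewrite deg_sum.
rewrite (tadpole_double_sum (V := nat) (F := fun _ _ => 1%N) n4)//.
transitivity ((1 + 1 + 1 + \sum_(2 <= k < n.-1) 1).*2)%N.
  by rewrite -addnn mulr2n.
by rewrite sum_nat_const_nat; lia.
Qed.

(** Indexing by [nat] accommodates sequences padded with zeros. The summand [k = n - 2] is the
    pendant edge. *)
Definition tadpole_energy {R : realType} (p : R) (n : nat) (a : nat -> R) : R :=
  `|a 0%N - a 1%N| `^ p + `|a 0%N - a 2%N| `^ p + `|a 1%N - a 2%N| `^ p +
  \sum_(2 <= k < n.-1) `|a k - a k.+1| `^ p.

Lemma edge_energy_tadpole {R : realType} (p : R) (n : nat) (a : nat -> R) :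
  (4 <= n)%N ->
  edge_energy (tadpole n 3) p (fun i : 'I_n => a i) = tadpole_energy p n a.
Proof.
move=> n4; rewrite /edge_energy.
rewrite (tadpole_double_sum (F := fun i j => `|a i - a j| `^ p) n4).
  by rewrite -[X in _ * X]mulr_natl mulrA mulVf ?mul1r// pnatr_eq0.
by move=> i j; rewrite distrC.
Qed.

Lemma lambda1p_tadpole_le {R : realType} (p : R) (n : nat) (a : nat -> R) :
  1 < p -> (4 <= n)%N -> a n.-1 = 0 -> (exists2 k, (k < n)%N & a k != 0) ->
  lambda1p (tadpole n 3) p * (\sum_(k < n) `|a k| `^ p) <= tadpole_energy p n a.
Proof.
move=> p1 n4 an [k kn ak].
rewrite -edge_energy_tadpole// -ler_pdivlMr.
  apply: lambda1p_le; split; last by exists (Ordinal kn).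
  by move=> x /(tadpole_boundary n4) ->.
by have := vertex_mass_gt0 p (f := fun i : 'I_n => a i) (x := Ordinal kn) ak.
Qed.

(** * Rearrangement on the tadpole *)

(* Each unordered edge occurs twice, so a vertex [x] accounts for two rows. *)
Lemma double_sum_remove (V : nmodType) (T : finType) (r : rel T)
    (F : T -> T -> V) (x : T) :
  symmetric r -> irreflexive r -> (forall u v, F u v = F v u) ->
  \sum_u \sum_(v | r u v) F u v =
  (\sum_(v | r x v) F x v) *+ 2 +
  \sum_u \sum_(v | [&& r u v, u != x & v != x]) F u v.
Proof.
move=> rsym rirr Fsym.
have rowE : \sum_u \sum_(v | (u == x) && r u v) F u v = \sum_(v | r x v) F x v.
  rewrite (bigD1 x)//= [X in _ + X]big1 ?addr0.
    by apply: eq_bigl => v; rewrite eqxx.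
  by move=> u /negbTE ->; rewrite big_pred0.
have colE : \sum_u \sum_(v | (v == x) && r v u) F u v = \sum_(v | r x v) F x v.
  rewrite (exchange_big_dep xpredT)//= -rowE; apply: eq_bigr => u _.
  by apply: eq_bigr => v _; exact: Fsym.
rewrite mulr2n -{1}rowE -{1}colE -!big_split /=; apply: eq_bigr => u _.
rewrite big_mkcond [X in X + _ + _]big_mkcond [X in _ + X + _]big_mkcond.
rewrite [X in _ + X]big_mkcond -!big_split /=; apply: eq_bigr => v _.
rewrite (rsym v u).
have [->|_] := eqVneq u x; have [->|_] := eqVneq v x; rewrite ?rirr /=;
  by rewrite ?andbF ?andbT; do ?[case: ifP => _]; rewrite ?addr0 ?add0r.
Qed.

Section EnergyBounds.
Context {R : realType} (p : R) (T : finType) (e : rel T).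
Hypothesis p1 : 1 < p.
Hypothesis eG : simple_graph e.

Let e_sym : symmetric e. Proof. by case: eG. Qed.
Let e_irr : irreflexive e. Proof. by case: eG. Qed.
Let pw_ge0 (x : R) : 0 <= `|x| `^ p. Proof. exact: powR_ge0. Qed.

(** The edges at [x] and the edges at [z] that avoid [x] are disjoint sets of edges. *)
Lemma edge_energy_two_rows (f : T -> R) (x z : T) : x != z ->
  \sum_(y | e x y) `|f x - f y| `^ p +
  \sum_(y | e z y && (y != x)) `|f z - f y| `^ p <= edge_energy e p f.
Proof.
move=> xz; rewrite /edge_energy.
have Fsym u v : `|f u - f v| `^ p = `|f v - f u| `^ p by rewrite distrC.
rewrite (double_sum_remove x e_sym e_irr Fsym).
rewrite (double_sum_remove (r := fun u v => [&& e u v, u != x & v != x]) z _ _ Fsym).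
- have -> : \sum_(y | e z y && (y != x)) `|f z - f y| `^ p =
            \sum_(y | [&& e z y, z != x & y != x]) `|f z - f y| `^ p.
    by apply: eq_bigl => v; rewrite (eq_sym z) xz.
  rewrite -[X in X + (_ + _)]mulr_natl -[X in _ + (X + _)]mulr_natl.
  have S0 : 0 <= \sum_u \sum_(v | [&& [&& e u v, u != x & v != x], u != z & v != z])
      `|f u - f v| `^ p by do 2!apply: sumr_ge0 => ? _.
  by lra.
- by move=> u v; rewrite e_sym; congr andb; rewrite andbC.
- by move=> u; rewrite e_irr.
Qed.

Lemma edge_energy_row (f : T -> R) (x : T) :
  \sum_(y | e x y) `|f x - f y| `^ p <= edge_energy e p f.
Proof.
rewrite /edge_energy.
have Fsym u v : `|f u - f v| `^ p = `|f v - f u| `^ p by rewrite distrC.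
rewrite (double_sum_remove x e_sym e_irr Fsym) -[X in X + _]mulr_natl.
have S0 : 0 <= \sum_u \sum_(v | [&& e u v, u != x & v != x])
      `|f u - f v| `^ p by do 2!apply: sumr_ge0 => ? _.
by lra.
Qed.

Lemma edge_energy_edge (f : T -> R) (x y : T) : e x y ->
  `|f x - f y| `^ p <= edge_energy e p f.
Proof.
move=> exy; apply: le_trans (edge_energy_row f x).
by rewrite (bigD1 y)//= lerDl sumr_ge0.
Qed.

Lemma sum_ge_two (P : pred T) (F : T -> R) (y z : T) :
  (forall u, 0 <= F u) -> P y -> P z -> y != z -> F y + F z <= \sum_(u | P u) F u.
Proof.
move=> F0 Py Pz yz; rewrite (bigD1 y)//= lerD2l (bigD1 z)/=; last first.
  by rewrite Pz eq_sym.
by rewrite lerDl sumr_ge0.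
Qed.

Lemma edge_energy_cut (f : T -> R) (c : R) :
  edge_energy e p (fun x => Num.min (f x) c) +
  edge_energy e p (fun x => Num.max (f x - c) 0) <= edge_energy e p f.
Proof.
rewrite /edge_energy -mulrDr ler_wpM2l// -big_split ler_sum// => x _.
by rewrite -big_split ler_sum// => y _; exact: normX_cut.
Qed.

Lemma edge_energy_cut_lt (f : T -> R) (c : R) (x y : T) :
  e x y -> f y < c -> c < f x ->
  edge_energy e p (fun x => Num.min (f x) c) +
  edge_energy e p (fun x => Num.max (f x - c) 0) < edge_energy e p f.
Proof.
move=> exy yc cx; rewrite /edge_energy -mulrDr ltr_pM2l ?invr_gt0//.
rewrite -big_split (bigD1 x)//= [X in _ < X](bigD1 x)//=.
apply: ltr_leD; last first.
  by rewrite ler_sum// => u _; rewrite -big_split ler_sum// => v _; exact: normX_cut.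
rewrite -big_split (bigD1 y)//= [X in _ < X](bigD1 y)//=.
apply: ltr_leD; first exact: normX_cut_lt.
by rewrite ler_sum// => v _; exact: normX_cut.
Qed.

Hypothesis eC : graph_connected e.
Context (b : T) (w : seq T).
Hypothesis b_notin : b \notin w.
Hypothesis w_uniq : uniq w.
Hypothesis w_deg : forall x, x \in w -> (1 < deg e x)%N.

Let v k := nth b w k.

(** [w] stands for the interior sorted by decreasing value. Since [b] is not in [w], the values
    along [nth b w] are padded with [f b = 0]. Cutting [f] at a level keeps it adapted to the same
    [w], which is what the induction on layers needs. *)
Definition adapted (f : T -> R) : Prop :=
  [/\ forall x, 0 <= f x, forall x, x \notin w -> f x = 0 &
      {homo (fun k => f (nth b w k)) : i j / (i <= j)%N >-> j <= i}].

Lemma adapted_min f c : 0 <= c -> adapted f -> adapted (fun x => Num.min (f x) c).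
Proof.
move=> c0 [f0 fw fv]; split=> [x|x xw|i j ij].
- by rewrite le_min f0.
- by rewrite fw// min_l.
- by rewrite le_min ge_min fv//= ge_min lexx orbT.
Qed.

Lemma adapted_max f c : 0 <= c -> adapted f -> adapted (fun x => Num.max (f x - c) 0).
Proof.
move=> c0 [f0 fw fv]; split=> [x|x xw|i j ij].
- by rewrite le_max lexx orbT.
- by rewrite fw// max_r// sub0r oppr_le0.
- by rewrite ge_max le_max lerB//=  ?fv// le_max lexx orbT.
Qed.

(* By the choice of default, [nth b w k] is the pendant vertex [b] for large [k]. *)
Lemma adapted_tail f k x : adapted f -> f (v k) = 0 ->
  (forall i, (i < k)%N -> x != v i) -> f x = 0.
Proof.
move=> [f0 fw fv] fk xk; have [xw|/fw//] := boolP (x \in w).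
apply/eqP; rewrite eq_le f0 andbT -fk -(nth_index b xw); apply: fv.
by rewrite leqNgt; apply/negP => /xk; rewrite /v nth_index// eqxx.
Qed.

Let f_tail2 f x : adapted f -> f (v 2) = 0 -> x != v 0 -> x != v 1 -> f x = 0.
Proof.
move=> fA f2 x0 x1; apply: (adapted_tail fA f2) => -[|[|]]//.
Qed.

Let v01 : (1 < size w)%N -> v 0 != v 1.
Proof. by move=> w2; rewrite nth_uniq// ltnW. Qed.

(** Only [v 0] and [v 1] carry values, and each has two neighbours where [f] vanishes. The bound
    exceeds the triangle by one term in [f (v 1)]; this surplus later rules out nonadjacency under
    equality. *)
Lemma energy_two_nonadjacent f : adapted f -> f (v 2) = 0 -> (1 < size w)%N ->
  ~~ e (v 0) (v 1) ->
  `|f (v 0) - f (v 1)| `^ p + `|f (v 0)| `^ p + `|f (v 1)| `^ p *+ 2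
  <= edge_energy e p f.
Proof.
move=> fA f2 w2 ne01; have v0v1 := v01 w2.
have [f0 fw fv] := fA.
apply: le_trans (edge_energy_two_rows f v0v1).
have /w_deg/card_gt1P[y [z []]] : v 0 \in w by rewrite mem_nth// ltnW.
have /w_deg/card_gt1P[y' [z' []]] : v 1 \in w by rewrite mem_nth.
rewrite !inE => ey' ez' yz' ey ez yz.
have nb0 u : e (v 0) u -> f u = 0.
  move=> eu; apply: f_tail2 => //; first by apply: contraTneq eu => ->; rewrite e_irr.
  by apply: contraTneq eu => ->.
have nb1 u : e (v 1) u -> f u = 0 /\ u != v 0.
  move=> eu; have u0 : u != v 0 by apply: contraTneq eu => ->; rewrite e_sym.
  by split=> //; apply: f_tail2 => //; apply: contraTneq eu => ->; rewrite e_irr.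
have [fy' y'0] := nb1 _ ey'; have [fz' z'0] := nb1 _ ez'.
apply: lerD.
  apply: le_trans (sum_ge_two (F := fun y => `|f (v 0) - f y| `^ p) _ ey ez yz) => //.
  rewrite (nb0 _ ey) (nb0 _ ez) subr0 lerD2r; apply: ler_normX => //.
  by rewrite !ger0_norm ?subr_ge0 ?fv// lerBlDr lerDl.
have := sum_ge_two (P := fun y => e (v 1) y && (y != v 0))
  (F := fun y => `|f (v 1) - f y| `^ p) (fun=> pw_ge0 _) _ _ yz'.
by rewrite ey' ez' y'0 z'0 fy' fz' subr0 mulr2n; exact.
Qed.

(** If [v 0] and [v 1] are adjacent, each has, by its degree, a further neighbour where [f]
    vanishes; these two edges and the common one pay for the triangle. *)
Lemma energy_triangle f : adapted f -> f (v 2) = 0 ->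
  `|f (v 0) - f (v 1)| `^ p + `|f (v 0) - f (v 2)| `^ p + `|f (v 1) - f (v 2)| `^ p
  <= edge_energy e p f.
Proof.
move=> fA f2; rewrite f2 !subr0; have [f0 fw fv] := fA.
have fb : f b = 0 by exact: fw.
case w1 : (size w) => [|[|k]].
- rewrite /v !nth_default ?w1// fb subrr !(norm0X p1) !addr0.
  exact: edge_energy_ge0.
- have v1 : v 1 = b by rewrite /v nth_default ?w1.
  rewrite v1 fb subr0 (norm0X p1) addr0.
  have /w_deg/card_gt1P[y [z []]] : v 0 \in w by rewrite mem_nth// w1.
  rewrite !inE => ey ez yz.
  have nb0 u : e (v 0) u -> f u = 0.
    move=> eu; apply: (adapted_tail (k := 1) fA); first by rewrite v1.
    by case=> // _; apply: contraTneq eu => ->; rewrite e_irr.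
  apply: le_trans (edge_energy_row f (v 0)).
  apply: le_trans (sum_ge_two (F := fun y => `|f (v 0) - f y| `^ p) _ ey ez yz) => //.
  by rewrite (nb0 _ ey) (nb0 _ ez) subr0.
have w2 : (1 < size w)%N by rewrite w1.
have [e01|ne01] := boolP (e (v 0) (v 1)); last first.
  apply: le_trans (energy_two_nonadjacent fA f2 w2 ne01).
  by rewrite lerD2l mulr2n lerDl.
have v0v1 := v01 w2.
have /w_deg/deg_ge2_avoid-/(_ (v 1))[y ey y1] : v 0 \in w by rewrite mem_nth// ltnW.
have /w_deg/deg_ge2_avoid-/(_ (v 0))[z ez z0] : v 1 \in w by rewrite mem_nth.
have fy : f y = 0.
  by apply: f_tail2 => //; apply: contraTneq ey => ->; rewrite e_irr.
have fz : f z = 0.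
  by apply: f_tail2 => //; apply: contraTneq ez => ->; rewrite e_irr.
apply: le_trans (edge_energy_two_rows f v0v1); apply: lerD.
  have := sum_ge_two (F := fun y => `|f (v 0) - f y| `^ p) (fun=> pw_ge0 _) e01 ey.
  by rewrite fy subr0 eq_sym => /(_ y1).
by rewrite (bigD1 z) ?ez//= fz subr0 lerDl sumr_ge0.
Qed.

(** Some edge leaves the set where [f >= c]. As [f (v k.+1) = 0], no value lies strictly between 0
    and [c], so this edge drops by all of [c]. *)
Lemma energy_level f k c : adapted f -> 0 < c -> f (v k) = c -> f (v k.+1) = 0 ->
  c `^ p <= edge_energy e p (fun x => Num.min (f x) c).
Proof.
move=> fA c0 fk fk1; have [f0 fw fv] := fA.
have kS : v k \in [set x | c <= f x]%SET by rewrite inE fk.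
have bS : b \notin [set x | c <= f x]%SET by rewrite inE fw// -ltNge.
have [x [y []]] := crossing_edge eG eC kS bS.
rewrite !inE -ltNge => exy cx yc.
apply: le_trans (edge_energy_edge _ exy).
have -> : f y = 0.
  apply: (adapted_tail fA fk1) => i ik; apply: contraTneq yc => ->.
  by rewrite -leNgt -fk fv.
by have {}c0 := ltW c0; rewrite min_r// min_l// subr0 ger0_norm.
Qed.

(** Induction peeling off the lowest layer, of height [c = f (v K.+2)]: it pays for the last path
    edge, and the part above [c] keeps all earlier differences. *)
Lemma energy_ge_path f K : adapted f -> f (v K.+2) = 0 ->
  `|f (v 0) - f (v 1)| `^ p + `|f (v 0) - f (v 2)| `^ p + `|f (v 1) - f (v 2)| `^ p
  + \sum_(2 <= k < K.+2) `|f (v k) - f (v k.+1)| `^ p <= edge_energy e p f.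
Proof.
elim: K f => [|K IH] f fA fK; first by rewrite big_geq// addr0; exact: energy_triangle.
rewrite big_nat_recr//= fK subr0 addrA.
have [f0 fw fv] := fA.
have [c0|c0] := eqVneq (f (v K.+2)) 0.
  by rewrite c0 (norm0X p1) addr0; exact: IH.
have {}c0 : 0 < f (v K.+2) by rewrite lt_def c0 f0.
set c := f (v K.+2) in c0 *.
apply: le_trans (edge_energy_cut f c); rewrite addrC; apply: lerD.
  by rewrite gtr0_norm//; exact: energy_level fA c0 erefl fK.
have gA := adapted_max (ltW c0) fA.
apply: le_trans (IH _ gA _); last by rewrite -/c subrr maxxx.
have gv i : (i <= K.+2)%N -> Num.max (f (v i) - c) 0 = f (v i) - c.
  by move=> iK; rewrite max_l// subr_ge0 fv.
have gd i j : (i <= K.+2)%N -> (j <= K.+2)%N ->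
    `|f (v i) - f (v j)| = `|Num.max (f (v i) - c) 0 - Num.max (f (v j) - c) 0|.
  by move=> iK jK; rewrite !gv// opprB addrA subrK.
rewrite !gd// lerD2l le_eqVlt; apply/orP; left; apply/eqP.
by apply: eq_big_nat => k /andP[_ kK]; rewrite gd// ltnW.
Qed.

Lemma tadpole_energy_le f n : (4 <= n)%N -> (size w < n)%N -> adapted f ->
  tadpole_energy p n (fun k => f (nth b w k)) <= edge_energy e p f.
Proof.
(* With [K = n - 3] the index [K.+2] is [n.-1], which is past the end of [w]. *)
move=> n4 wn fA; have -> : n = (n - 3).+3 by lia.
apply: energy_ge_path => //; rewrite /v nth_default; first by case: fA => _ /(_ b)->.
by lia.
Qed.

End EnergyBounds.

(** * Minimizers on the tadpole are strictly decreasing *)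

Section TadpoleMinimizer.
Context {R : realType} (p : R) (n : nat) (a : nat -> R).
Hypothesis p1 : 1 < p.
Hypothesis a_ge0 : forall k, 0 <= a k.
Hypothesis a_mono : {homo a : i j / (i <= j)%N >-> j <= i}.
Hypothesis a0_gt0 : 0 < a 0%N.
Hypothesis a_last : a n.-1 = 0.
Hypothesis E_gt0 : 0 < tadpole_energy p n a.
Hypothesis a_min : forall g : nat -> R, g n.-1 = 0 ->
  (exists2 k, (k < n)%N & g k != 0) ->
  tadpole_energy p n a * \sum_(k < n) `|g k| `^ p <=
  tadpole_energy p n g * \sum_(k < n) `|a k| `^ p.

Let mass_split (g : nat -> R) : (0 < n)%N ->
  \sum_(k < n) `|g k| `^ p = `|g 0%N| `^ p + \sum_(1 <= k < n) `|g k| `^ p.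
Proof. by move=> n0; rewrite -(big_mkord xpredT (fun k => `|g k| `^ p)) big_ltn. Qed.

(* Raising a plateau by [h] costs [O(h^p)] energy but gains mass of order [h]. *)
Lemma tadpole_raise_absurd (b : R -> nat -> R) : (0 < n)%N ->
  (forall h, 0 < h -> [/\ b h 0%N = a 0%N + h, b h n.-1 = 0,
     forall k, a k <= b h k &
     tadpole_energy p n (b h) <= tadpole_energy p n a + 2 * h `^ p]) -> False.
Proof.
move=> n0 bP.
have E_gt0' := E_gt0; have a_min' := a_min.
set E := tadpole_energy p n a in E_gt0' a_min' bP.
set M := \sum_(k < n) `|a k| `^ p in a_min'.
set A := (a 0%N) `^ (p - 1).
have A0 : 0 < A by exact: powR_gt0.
have M0 : 0 < M.
  rewrite /M mass_split// ltr_pwDl//; first by rewrite normX_gt0// gt_eqF.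
  by apply: sumr_ge0 => ? _; exact: powR_ge0.
(* Entry 0 alone gains mass [h * A]; minimality then gives [E * h * A <= 2 * M * h^p], to be divided
   by [h]. *)
have key h : 0 < h -> E * A <= 2 * M * h `^ (p - 1).
  move=> h0; have [b0 bl ab bE] := bP h h0.
  have bM : M + h * A <= \sum_(k < n) `|b h k| `^ p.
    rewrite /M !mass_split// b0 addrAC lerD//.
      rewrite !ger0_norm ?addr_ge0// ?(ltW h0)//.
      by apply: powR_increment => //; exact: ltW.
    apply: ler_sum_nat => k _; apply: ler_normX => //.
    by rewrite !ger0_norm//; exact: le_trans (ab k).
  have : E * (M + h * A) <= (E + 2 * h `^ p) * M.
    apply: le_trans (ler_wpM2l (ltW E_gt0') bM) _.
    apply: le_trans (ler_wpM2r (ltW M0) bE).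
    apply: a_min' => //; exists 0%N => //.
    by rewrite b0 gt_eqF// addr_gt0.
  rewrite -(@mulr_powRB1 _ h p) ?(ltW h0)//; last exact: lt_trans p1.
  move=> le; rewrite -(ler_pM2l h0).
  by move: (h `^ (p - 1)) le => x; lra.
(* Chosen so that the right side of [key] is half of its left side. *)
pose h := (E * A / (4 * M)) `^ (p - 1)^-1.
have q0 : 0 < E * A / (4 * M) by rewrite divr_gt0 ?mulr_gt0.
have p10 : p - 1 != 0 by rewrite gt_eqF// subr_gt0.
have hE : h `^ (p - 1) = E * A / (4 * M).
  by rewrite /h -powRrM mulVf// powRr1// ltW.
have := key h (powR_gt0 _ q0); rewrite hE.
have -> : 2 * M * (E * A / (4 * M)) = E * A / 2.
  rewrite invfM; have : M * M^-1 = 1 by rewrite mulfV// gt_eqF.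
  by move: (M^-1) => x Mx; have -> : 2 * M * (E * A * (4^-1 * x)) = 2 * E * A * 4^-1 * (M * x); [ring|rewrite Mx; lra].
have := mulr_gt0 E_gt0' A0; lra.
Qed.

(** On a plateau [a k = a k.+1], raising the entries [0..k] by [h] stretches only edges of length 0:
    one if [k >= 2], and two, [{0,2}] and [{1,2}], if [k = 1] and [a 0 = a 1]. If [k = 1] and
    [a 0 > a 1], the edge [{0,2}] has positive length and another competitor is used. *)
Lemma tadpole_minimizer_strict k : (4 <= n)%N -> (0 < k < n.-1)%N -> a k.+1 < a k.
Proof.
move=> n4 /andP[k0 kn]; rewrite lt_def a_mono// andbT.
apply/negP => /eqP akE.
have n0 : (0 < n)%N by lia.
have [/andP[/eqP k1 a01]|] := boolP ((k == 1%N) && (a 1%N != a 0%N)).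
  (* Lifting the second entry to the first one leaves the energy unchanged. *)
  rewrite k1 in akE.
  pose g i := if (i == 1)%N then a 0%N else a i.
  have gl : g n.-1 = 0 by rewrite /g ifF//; lia.
  have gE : tadpole_energy p n g = tadpole_energy p n a.
    rewrite /tadpole_energy /g /= subrr (norm0X p1) add0r -akE subrr (norm0X p1) addr0.
    congr (_ + _); apply: eq_big_nat => i /andP[i2 _].
    by rewrite !ifF//; lia.
  have := a_min gl; rewrite gE ler_pM2l//.
  have g0 : exists2 k, (k < n)%N & g k != 0 by exists 0%N => //; rewrite gt_eqF.
  move=> /(_ g0); rewrite !mass_split// lerD2l => le.
  have a1lt : a 1%N < a 0%N by rewrite lt_def a_mono// eq_sym a01.
  move: le; rewrite big_ltn; last by lia.
  rewrite [X in _ <= X]big_ltn; last by lia.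
  rewrite {1}/g /= (eq_big_nat _ _ (F2 := fun i => `|a i| `^ p)); last first.
    by move=> i /andP[i2 _]; rewrite /g ifF//; lia.
  rewrite lerD2r !ger0_norm// leNgt gt0_ltr_powR ?nnegrE//.
  exact: lt_trans p1.
move=> knot1.
apply: (@tadpole_raise_absurd (fun h i => if (i <= k)%N then a i + h else a i)) => // h h0.
have kn' : (n.-1 <= k)%N = false by lia.
split => //; first by rewrite kn'.
  by move=> i; case: ifP => // _; rewrite lerDl ltW.
have hp0 : 0 <= h `^ p by exact: powR_ge0.
have dE i j : a i + h - (a j + h) = a i - a j by rewrite opprD addrACA subrr addr0.
have rest (i : nat) : (k < i)%N -> ((i <= k)%N = false) * ((i.+1 <= k)%N = false).
  by move=> ki; split; lia.
have addK (x : R) : x + h - x = h by rewrite addrAC subrr add0r.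
rewrite /tadpole_energy /= k0.
have [k1|k1] := eqVneq k 1%N.
  move: knot1 rest; rewrite k1 eqxx /= negbK => /eqP a10 rest.
  rewrite k1 in akE; rewrite -akE a10 !dE addK subrr (norm0X p1) gtr0_norm//.
  rewrite (eq_big_nat _ _ (F2 := fun i => `|a i - a i.+1| `^ p)); first by lra.
  by move=> i /andP[i2 _]; have [-> ->] := rest i i2.
have k2 : (1 < k)%N by lia.
have kin : k \in index_iota 2 n.-1 by rewrite mem_index_iota; lia.
rewrite k2 !dE -[X in _ <= X]addrA lerD2l.
rewrite (bigD1_seq k)//= ?iota_uniq// [X in _ <= X + _](bigD1_seq k)//= ?iota_uniq//.
rewrite leqnn ltnn -akE addK subrr (norm0X p1) add0r gtr0_norm// addrC.
apply: lerD; last by lra.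
apply: ler_sum => i ik; case: (ltngtP i k) => [ilt|igt|/eqP].
- by rewrite dE.
- by [].
- by rewrite (negbTE ik).
Qed.

End TadpoleMinimizer.

(** * Rigidity *)

(** The image of the tadpole already has [n] edges, hence contains all edges of the graph; by
    connectedness every vertex lies on an edge, so [u] reaches every vertex. *)
Lemma tadpole_iso_of_embedding (T : finType) (e : rel T) (n : nat) (u : nat -> T) :
  simple_graph e -> graph_connected e -> num_edges e = n -> (4 <= n)%N ->
  {in [pred i | (i < n)%N] &, injective u} ->
  e (u 0%N) (u 1%N) -> e (u 0%N) (u 2) -> e (u 1%N) (u 2) ->
  (forall k, (2 <= k < n.-1)%N -> e (u k) (u k.+1)) ->
  graph_iso e (tadpole n 3).
Proof.
move=> eG eC en n4 uinj u01 u02 u12 upath.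
have [esym eirr] := eG.
pose phi (i : 'I_n) := u i.
have phi_inj : injective phi.
  by move=> i j ij; apply: val_inj; apply: uinj ij; exact: ltn_ord.
have up k : (k.+1 < n)%N -> e (u k) (u k.+1).
  by case: k => [|[|k]] kn//; apply: upath; lia.
have hom i j : tadpole n 3 i j -> e (phi i) (phi j).
  rewrite /phi; case/or4P => [/eqP ij|/eqP ji|/andP[/eqP -> /eqP ->]|/andP[/eqP -> /eqP ->]]//=.
  - by rewrite -ij up// ij ltn_ord.
  - by rewrite esym -ji up// ji ltn_ord.
  - by rewrite esym.
pose phi2 (q : 'I_n * 'I_n) := (phi q.1, phi q.2).
have phi2_inj : injective phi2.
  by case=> [i j] [i' j'] [/phi_inj -> /phi_inj ->].
have imE : (phi2 @: [set q | tadpole n 3 q.1 q.2] = [set q | e q.1 q.2])%SET.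
  apply/eqP; rewrite eqEcard; apply/andP; split.
    by apply/fintype.subsetP => _ /imsetP[q + ->]; rewrite !inE; exact: hom.
  rewrite card_imset// -!sum_deg_card handshake// en.
  by rewrite tadpole_sum_deg.
have preim x y : e x y -> exists i j, [/\ x = phi i, y = phi j & tadpole n 3 i j].
  move=> exy; have : (x, y) \in [set q : T * T | e q.1 q.2]%SET by rewrite inE.
  by rewrite -imE => /imsetP[[i j]]; rewrite inE => tij [-> ->]; exists i, j.
have u0u1 : u 0%N != u 1%N.
  by apply/eqP => /uinj E; have : 0%N = 1%N by apply: E; rewrite inE; lia.
have surj x : exists i, phi i = x.
  have [y xy] : exists y, x != y.
    by have [->|] := eqVneq x (u 0%N); [exists (u 1%N)|exists (u 0%N)].
  have /deg_gt0P[z /preim[i [j [-> _ _]]]] := deg_gt0 eG eC xy.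
  by exists i.
have /inj_card_bij [|psi psiK phiK] := phi_inj.
  rewrite -(card_codom phi_inj); apply/subset_leq_card/fintype.subsetP => x _.
  by have [i <-] := surj x; exact: codom_f.
exists psi; split; first by exists phi.
move=> x y; rewrite -{2}(phiK x) -{2}(phiK y); apply/idP/idP => [/hom//|].
by move=> /preim[i [j [/phi_inj -> /phi_inj ->]]].
Qed.

Section EqualityCase.
Context {R : realType} (p : R) (T : finType) (e : rel T) (n : nat).
Context (b : T) (w : seq T) (f : T -> R).
Hypothesis p1 : 1 < p.
Hypothesis eG : simple_graph e.
Hypothesis eC : graph_connected e.
Hypothesis en : num_edges e = n.
Hypothesis n4 : (4 <= n)%N.
Hypothesis b_notin : b \notin w.
Hypothesis w_uniq : uniq w.
Hypothesis w_deg : forall x, x \in w -> (1 < deg e x)%N.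
Hypothesis wn : (size w < n)%N.
Hypothesis fA : adapted b w f.

Let v k := nth b w k.
Let a k := f (v k).

Hypothesis f_eq : edge_energy e p f = tadpole_energy p n a.
Hypothesis a_strict : forall k, (0 < k < n.-1)%N -> a k.+1 < a k.

Let f_ge0 x : 0 <= f x. Proof. by case: fA. Qed.
Let f_off x : x \notin w -> f x = 0. Proof. by case: fA => _ + _; apply. Qed.
Let a_mono : {homo a : i j / (i <= j)%N >-> j <= i}. Proof. by case: fA. Qed.
Let e_irr : irreflexive e. Proof. by case: eG. Qed.

Let a_gt0 k : (k < n.-1)%N -> 0 < a k.
Proof.
move=> kn; case: k kn => [|k] kn; last by apply: le_lt_trans (f_ge0 _) (a_strict _).
by apply: lt_le_trans (a_mono (leq0n 1)); apply: le_lt_trans (f_ge0 _) (a_strict _); lia.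
Qed.

Let in_w x : 0 < f x -> x \in w.
Proof. by apply: contraTT => /f_off ->; rewrite ltxx. Qed.

Let w_size : size w = n.-1.
Proof.
(* Past the end of [w] the value would be [f b = 0], against [a n.-2 > 0]. *)
suff : (n.-2 < size w)%N by lia.
rewrite ltnNge; apply/negP => wle.
have := a_gt0 (k := n.-2); rewrite /a /v nth_default// f_off// ltxx.
by apply/implyP; lia.
Qed.

Let v_in k : (k < n.-1)%N -> v k \in w.
Proof. by move=> kn; rewrite mem_nth// w_size. Qed.

Let vP x : x \in w -> exists2 k, (k < n.-1)%N & x = v k.
Proof.
by move=> xw; exists (index x w); rewrite /v ?nth_index// -w_size index_mem.
Qed.

Let a_lt i j : (0 < i)%N -> (i < j)%N -> (i < n.-1)%N -> a j < a i.
Proof.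
move=> i0 ij iN; apply: le_lt_trans (a_mono ij) (a_strict _).
by rewrite i0.
Qed.

(** The sequence is strict on both sides of [k]. The range starts at 2 because [a 0 = a 1] is
    possible. *)
Let level_unique k x : (1 < k < n.-1)%N -> f x = a k -> x = v k.
Proof.
move=> /andP[k1 kn] fx.
have /in_w/vP[j jn xE] : 0 < f x by rewrite fx a_gt0.
rewrite xE; congr v; move: fx; rewrite xE -/(a j).
have [jk|kj|//] := ltngtP j k => ajk.
  have jk1 : (j <= k.-1)%N by lia.
  have : a k < a k.-1 by apply: a_lt; lia.
  by rewrite ltNge -ajk a_mono.
have : a j < a k by apply: a_lt => //; lia.
by rewrite ajk ltxx.
Qed.

(** For [k >= 2] no tadpole edge passes over the index [k], so the cut is exact on every edge; at
    [k = 1] the chord [{0,2}] would. *)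
Let tadpole_energy_cut k : (1 < k)%N ->
  tadpole_energy p n (fun i => Num.min (a i) (a k)) +
  tadpole_energy p n (fun i => Num.max (a i - a k) 0) = tadpole_energy p n a.
Proof.
move=> k2.
have cut i j : (i <= j)%N -> (j <= k)%N || (k <= i)%N ->
    `|a i - a j| `^ p = `|Num.min (a i) (a k) - Num.min (a j) (a k)| `^ p +
    `|Num.max (a i - a k) 0 - Num.max (a j - a k) 0| `^ p.
  move=> ij /orP[jk|ki].
    have ik := leq_trans ij jk.
    rewrite !min_r ?a_mono// !max_l ?subr_ge0 ?a_mono// subrr (norm0X p1) add0r.
    by rewrite opprB addrA subrK.
  have kj := leq_trans ki ij.
  by rewrite !min_l ?a_mono// !max_r ?subr_le0 ?a_mono// subrr (norm0X p1) addr0.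
rewrite /tadpole_energy !cut ?k2 ?(ltnW k2)//.
under [X in _ = _ + X]eq_bigr => i _ do rewrite cut ?leqnSn ?ltnNge ?orNb ?orbN//.
by rewrite big_split /=; lra.
Qed.

(** Each layer costs at least as much on the graph as on the tadpole, while the totals agree by
    [f_eq]; hence equality throughout. *)
Let cut_eq k : (1 < k)%N ->
  edge_energy e p (fun x => Num.min (f x) (a k)) +
  edge_energy e p (fun x => Num.max (f x - a k) 0) = edge_energy e p f /\
  edge_energy e p (fun x => Num.max (f x - a k) 0) =
  tadpole_energy p n (fun i => Num.max (a i - a k) 0).
Proof.
move=> k2; have := edge_energy_cut e p1 f (a k).
have := tadpole_energy_cut k2; rewrite -f_eq.
have := tadpole_energy_le p1 eG eC b_notin w_uniq w_deg n4 wn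
  (adapted_min (f_ge0 (v k)) fA).
have := tadpole_energy_le p1 eG eC b_notin w_uniq w_deg n4 wn
  (adapted_max (f_ge0 (v k)) fA).
by rewrite -/(a k) => A B C D; split; lra.
Qed.

(* A jumped level would make the superadditivity estimate strict. *)
Let no_jump k x y : (1 < k)%N -> e x y -> a k < f x -> a k <= f y.
Proof.
move=> k2 exy xk; rewrite leNgt; apply/negP => yk.
have [E _] := cut_eq k2.
by have := edge_energy_cut_lt p1 exy yk xk; rewrite E ltxx.
Qed.

(** Otherwise the layer above [a 2] would carry the surplus [(a 1 - a 2)^p > 0] of
    [energy_two_nonadjacent], against [cut_eq]. *)
Let adj01 : e (v 0) (v 1).
Proof.
apply/negPn/negP => ne01.
have [_ E] := cut_eq (leqnn 2).
have gA := adapted_max (f_ge0 (v 2)) fA.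
have g2 : Num.max (f (v 2) - f (v 2)) 0 = 0 by rewrite subrr maxxx.
have w2 : (1 < size w)%N by rewrite w_size; lia.
have := energy_two_nonadjacent p1 eG w_uniq w_deg gA g2 w2 ne01.
rewrite -/(a 2) -/(a 1) -/(a 0) E /tadpole_energy.
rewrite [a 2 - a 2]subrr maxxx !subr0 big1_seq ?addr0.
  rewrite lerD2l mulr2n gerDl leNgt normX_gt0//.
  have := @a_strict 1%N; rewrite gt_eqF// lt_max subr_gt0 a_strict//; lia.
move=> i /andP[_]; rewrite mem_index_iota => /andP[i2 _].
by rewrite !max_r ?subr_le0 ?a_mono ?leqW// subrr (norm0X p1).
Qed.

Let above2 x : a 2 <= f x -> x != v 0 -> x != v 1 -> x = v 2.
Proof.
move=> fx x0 x1; have a2 : 0 < a 2 by apply: a_gt0; lia.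
have /in_w/vP[j jn xE] := lt_le_trans a2 fx.
apply: level_unique; first by lia.
apply/eqP; rewrite eq_le fx andbT xE a_mono//.
by case: j xE {jn} => [|[|//]] xE; rewrite xE eqxx in x0 x1.
Qed.

(** [x] has a neighbour other than [y]; by [no_jump] its value is at least [a 2], which leaves only
    [v 2]. *)
Let adj_top (x y : T) : x \in [:: v 0; v 1] -> y \in [:: v 0; v 1] -> x != y -> e x (v 2).
Proof.
move=> xT yT xy.
have a12 : a 2 < a 1 by apply: a_strict; lia.
have fx : a 2 < f x.
  move: xT; rewrite !inE => /orP[] /eqP -> //.
  by apply: lt_le_trans a12 (a_mono _).
have /w_deg/deg_ge2_avoid-/(_ y)[z exz zy] : x \in w.
  by move: xT; rewrite !inE => /orP[] /eqP ->; apply: v_in; lia.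
have zx : z != x by apply: contraTneq exz => ->; rewrite e_irr.
have fz := no_jump (leqnn 2) exz fx.
rewrite -(above2 fz)//; apply/eqP => zv; move: xT yT zx zy xy;
  rewrite zv !inE => /orP[] /eqP -> /orP[] /eqP ->; rewrite eqxx//.
Qed.

(** An edge leaves the set where [f >= a k]; by [no_jump] its upper end cannot lie strictly above
    [a k], so it is [v k]. *)
Let down k : (1 < k < n.-1)%N -> exists2 y, e (v k) y & f y < a k.
Proof.
move=> kP; have ak : 0 < a k by apply: a_gt0; lia.
have S0 : v 0 \in [set x | a k <= f x]%SET by rewrite inE a_mono.
have Sb : b \notin [set x | a k <= f x]%SET by rewrite inE f_off// -ltNge.
have [x [y []]] := crossing_edge eG eC S0 Sb.
rewrite !inE -ltNge => exy kx yk; exists y => //.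
rewrite -(level_unique kP (x := x))//; apply/eqP; rewrite eq_le kx andbT leNgt.
apply/negP => /(no_jump _ exy); rewrite leNgt yk => /(_ _)/implyP; lia.
Qed.

(** The lower neighbour from [down] has value at least [a k.+1] by [no_jump], and less than [a k],
    so it is [v k.+1]. *)
Let path_edge k : (1 < k < n.-2)%N -> e (v k) (v k.+1).
Proof.
move=> kP; have kP' : (1 < k < n.-1)%N by lia.
have [y ey yk] := down kP'.
have k1 : a k.+1 <= f y.
  by apply: no_jump ey _; [lia|apply: a_strict; lia].
rewrite -(@level_unique k.+1 y) ?ey//; first by lia.
have ak : 0 < a k.+1 by apply: a_gt0; lia.
have /in_w/vP[j jn yE] := lt_le_trans ak k1.
apply/eqP; rewrite eq_le k1 andbT yE a_mono// ltnNge; apply/negP => jk.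
by have := a_mono jk; rewrite leNgt {1}/a -yE yk.
Qed.

Lemma equality_case_iso : graph_iso e (tadpole n 3).
Proof.
have n2P : (1 < n.-2 < n.-1)%N by lia.
have [t et tk] := down n2P.
have tw : t \notin w.
  apply/negP => /vP[j jn tE]; move: tk; rewrite ltNge tE a_mono//; lia.
(* The pendant end is sent to [t], a neighbour of [v n.-2]; the default [b] is not known to be
   adjacent to it. *)
pose u k := if (k < n.-1)%N then v k else t.
have uv k : (k < n.-1)%N -> u k = v k by rewrite /u => ->.
apply: (@tadpole_iso_of_embedding _ _ _ u) => //.
- have un k : (k < n)%N -> (k < n.-1)%N = false -> k = n.-1 by lia.
  move=> i j; rewrite !inE /u => iN jN.
  case: ifP => iP; case: ifP => jP.
  + by move/eqP; rewrite nth_uniq ?w_size// => /eqP.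
  + by move=> E; rewrite -E v_in in tw.
  + by move=> E; rewrite E v_in in tw.
  + by rewrite (un _ iN iP) (un _ jN jP).
- by rewrite !uv ?adj01//; lia.
- rewrite !uv; [|lia|lia].
  by apply: (adj_top (y := v 1)); rewrite ?inE ?eqxx ?orbT// nth_uniq// w_size; lia.
- rewrite !uv; [|lia|lia].
  by apply: (adj_top (y := v 0)); rewrite ?inE ?eqxx ?orbT// nth_uniq// w_size; lia.
move=> k kP; rewrite uv; last by lia.
have [kn|kn] := ltnP k n.-2.
  by rewrite uv ?path_edge//; lia.
have -> : k = n.-2 by lia.
by rewrite /u ifF//; lia.
Qed.

End EqualityCase.

(** * Invariance under isomorphism, sorted interior values, and the comparison of eigenvalues *)

Lemma lambda1p_iso_le (R : realType) (p : R) (T1 T2 : finType)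
    (e1 : rel T1) (e2 : rel T2) :
  graph_iso e1 e2 -> (exists x, x \notin boundary e2) ->
  lambda1p e1 p <= lambda1p e2 p.
Proof.
move=> [phi [phi_bij phi_hom]] [x0 x0I].
have degE x : deg e2 (phi x) = deg e1 x.
  by rewrite !deg_sum (reindex phi (onW_bij _ phi_bij))//=; apply: eq_bigl => y; exact: phi_hom.
apply: lb_le_inf.
  (* The indicator of an interior vertex shows that the infimum is over a nonempty set. *)
  exists (edge_energy e2 p (fun x => (x == x0)%:R) / vertex_mass p (fun x => (x == x0)%:R)).
  exists (fun x => (x == x0)%:R) => //; split; last first.
    by exists x0; rewrite eqxx oner_neq0.
  by move=> x xB; case: eqP => // xx0; rewrite xx0 (negbTE x0I) in xB.
move=> _ [g [gB [x gx]] <-].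
have -> : edge_energy e2 p g = edge_energy e1 p (g \o phi).
  rewrite /edge_energy (reindex phi (onW_bij _ phi_bij))//=; congr (_ * _); apply: eq_bigr => y _.
  by rewrite (reindex phi (onW_bij _ phi_bij))//=; apply: eq_bigl => z; exact: phi_hom.
have -> : vertex_mass p g = vertex_mass p (g \o phi).
  by rewrite /vertex_mass (reindex phi (onW_bij _ phi_bij)).
apply: lambda1p_le; split; last first.
  by have [psi _ phiK] := phi_bij; exists (psi x); rewrite /= phiK.
by move=> y yB; apply: gB; rewrite inE degE; rewrite inE in yB.
Qed.

Section SortedInterior.
Context {R : realType} (T : finType) (e : rel T) (f : T -> R).

Definition sorted_interior : seq T :=
  sort (fun x y => f y <= f x) (enum (~: boundary e)).

Lemma mem_sorted_interior x : (x \in sorted_interior) = (x \notin boundary e).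
Proof. by rewrite mem_sort mem_enum finset.in_setC. Qed.

Lemma sorted_interior_uniq : uniq sorted_interior.
Proof. by rewrite sort_uniq enum_uniq. Qed.

Lemma sorted_interior_adapted b : b \in boundary e -> (forall x, 0 <= f x) ->
  (forall x, x \in boundary e -> f x = 0) -> adapted b sorted_interior f.
Proof.
move=> bB f0 fB; split=> // [x|i j ij]; first by rewrite mem_sorted_interior negbK => /fB.
have [jw|wj] := ltnP j (size sorted_interior); last by rewrite (nth_default b wj) fB.
apply: (sorted_leq_nth (leT := fun x y => f y <= f x)) => //.
- by move=> x y z yx zx; exact: le_trans zx yx.
- by apply: sort_sorted => x y; exact: le_total.
- by rewrite inE; exact: leq_ltn_trans jw.
Qed.

Lemma vertex_mass_sorted_interior p b n : 1 < p -> b \in boundary e ->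
  (forall x, x \in boundary e -> f x = 0) -> (size sorted_interior <= n)%N ->
  vertex_mass p f = \sum_(k < n) `|f (nth b sorted_interior k)| `^ p.
Proof.
move=> p1 bB fB wn; rewrite /vertex_mass (bigID (mem sorted_interior)) /=.
rewrite [X in _ + X]big1 ?addr0; last first.
  by move=> x; rewrite mem_sorted_interior negbK => /fB ->; exact: norm0X.
rewrite -big_uniq ?sorted_interior_uniq// (big_nth b).
rewrite -(big_mkord xpredT (fun k => `|f (nth b sorted_interior k)| `^ p)).
rewrite [RHS](big_cat_nat _ wn)//= [X in _ + X]big1_seq ?addr0// => k.
by rewrite mem_index_iota => /andP[_ /andP[wk _]]; rewrite nth_default// fB// norm0X.
Qed.

End SortedInterior.

Lemma edge_energy_gt0 (R : realType) (p : R) (T : finType) (e : rel T)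
    (f : T -> R) (x y : T) :
  simple_graph e -> graph_connected e -> f x != 0 -> f y = 0 ->
  0 < edge_energy e p f.
Proof.
move=> eG eC fx fy.
have xS : x \in [set x | f x != 0]%SET by rewrite inE.
have yS : y \notin [set x | f x != 0]%SET by rewrite inE fy eqxx.
have [u [v []]] := crossing_edge eG eC xS yS; rewrite !inE negbK => euv fu /eqP fv.
apply: lt_le_trans (edge_energy_edge p eG f euv).
by rewrite fv subr0 normX_gt0.
Qed.

Theorem theorem1p3 (R : realType) (p : R) (T : finType) (e : rel T) (n : nat) :
  1 < p ->
  simple_graph e ->
  graph_connected e ->
  num_edges e = n ->
  (4 <= n)%N ->
  boundary e != finset.set0 ->
  lambda1p (tadpole n 3) p <= lambda1p e p /\
  (lambda1p e p = lambda1p (tadpole n 3) p <-> graph_iso e (tadpole n 3)).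
Proof.
move=> p1 eG eC en n4 /set0Pn[b bB].
have n2 : (1 < num_edges e)%N by rewrite en; lia.
have [f [f0 CBf fmin]] := exists_minimizer p1 (interior_exists eG eC bB n2).
have lamE := lambda1p_min CBf fmin; have [fB [z fz]] := CBf.
pose w := sorted_interior e f.
have wn : (size w < n)%N.
  by rewrite size_sort -cardE -en; exact: interior_card bB.
have bw : b \notin w by rewrite mem_sorted_interior negbK.
have w_uniq := sorted_interior_uniq e f.
have w_deg x : x \in w -> (1 < deg e x)%N.
  by rewrite mem_sorted_interior; exact: interior_deg bB.
have fA := sorted_interior_adapted bB f0 fB.
pose a k := f (nth b w k).
have massE : vertex_mass p f = \sum_(k < n) `|a k| `^ p.
  exact: vertex_mass_sorted_interior p1 bB fB (ltnW wn).
have M0 : 0 < vertex_mass p f by exact: vertex_mass_gt0 fz.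
have TE : tadpole_energy p n a <= edge_energy e p f.
  exact: tadpole_energy_le wn fA.
have a0 : a 0%N != 0.
  have zw : z \in w by rewrite mem_sorted_interior; apply: contraNN fz => /fB ->.
  rewrite gt_eqF//; apply: lt_le_trans (_ : f z <= _); first by rewrite lt_def fz f0.
  by have [_ _ /(_ 0%N (index z w))] := fA; rewrite /= nth_index//; exact.
have al : a n.-1 = 0 by rewrite /a nth_default ?fB//; lia.
have lamT : lambda1p (tadpole n 3) p * vertex_mass p f <= tadpole_energy p n a.
  by rewrite massE lambda1p_tadpole_le//; exists 0%N => //; lia.
have lam_le : lambda1p (tadpole n 3) p <= lambda1p e p.
  by rewrite lamE ler_pdivlMr//; exact: le_trans TE.
split=> //; split=> [eq|iso]; last first.
  apply/eqP; rewrite eq_le lam_le andbT; apply: lambda1p_iso_le iso _.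
  have n0 : (0 < n)%N by lia.
  exists (Ordinal n0); apply/negP => /(tadpole_boundary n4) /=; lia.
have lamEf : lambda1p (tadpole n 3) p * vertex_mass p f = edge_energy e p f.
  by rewrite -eq lamE divfK// gt_eqF.
(* Equal eigenvalues squeeze the tadpole energy between [lambda1p (tadpole n 3) p * vertex_mass p f]
   and the same number. *)
have fE : edge_energy e p f = tadpole_energy p n a.
  by apply/eqP; rewrite eq_le TE andbT -lamEf.
apply: (@equality_case_iso _ p _ _ n b w f) => //.
move=> k kn; apply: (@tadpole_minimizer_strict _ p n a) => //.
- by move=> i; exact: f0.
- by case: fA.
- by rewrite lt_def a0 f0.
- by rewrite -fE; exact: edge_energy_gt0 eG eC fz (fB _ bB).
(* By [fE] and [lamEf], the sequence [a] attains the tadpole eigenvalue, so its minimality is the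
   Rayleigh bound for [g] times the mass. *)
move=> g gl g0; rewrite -fE -lamEf mulrAC -massE ler_wpM2r ?(ltW M0)//.
exact: lambda1p_tadpole_le.
Qed.
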